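(* Let $n\ge p$, $\mathcal X\in\mathrm{St}(n,p,l)$, $\mathcal U,\mathcal V\in T_{\mathcal X}\mathrm{St}(n,p,l)$, and let $R_{\mathcal X}(\mathcal U)=(\mathcal X+\mathcal U)*(\mathcal I+\mathcal U^\top*\mathcal U)^{-1/2}$ be the t-PD based retraction. Put $\mathcal P=(\mathcal I+\mathcal U^\top*\mathcal U)^{1/2}$, $\mathcal Y=R_{\mathcal X}(\mathcal U)=(\mathcal X+\mathcal U)*\mathcal P^{-1}$, and let $\mathcal S\in\mathbb R^{p\times p\times l}$ be given by $$\operatorname{vec}(\mathcal S)=\big(\widetilde{\operatorname{bcirc}}(\mathcal P)^\top\otimes I_p+[I_p]_{l\times l}\odot\operatorname{bcirc}(\mathcal P)\big)^{\dagger}\operatorname{vec}(\mathcal Y^\top*\mathcal V-\mathcal V^\top*\mathcal Y).$$ Then the vector transport by differentiated retraction $\mathcal T_{\mathcal U}\mathcal V:=\frac{d}{dt}R_{\mathcal X}(\mathcal U+t\mathcal V)\big|_{t=0}$ equals $$\mathcal T_{\mathcal U}\mathcal V=\mathcal Y*\mathcal S+(\mathcal I-\mathcal Y*\mathcal Y^\top)*\mathcal V*(\mathcal Y^\top*(\mathcal X+\mathcal U))^{-1}.$$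
   Context: Frontal slices $A^{(i)}=\mathcal A(:,:,i)$. $\operatorname{bcirc}(\mathcal A)$ is the block circulant matrix whose $(i,j)$ block is $A^{(((i-j)\bmod l)+1)}$, and $\widetilde{\operatorname{bcirc}}(\mathcal A)$ is the block matrix whose $(i,j)$ block is $A^{(((j-i)\bmod l)+1)}$ (first block row $A^{(1)},A^{(2)},\dots,A^{(l)}$). The t-product is $\mathcal A*\mathcal B=\operatorname{fold}(\operatorname{bcirc}(\mathcal A)\operatorname{unfold}(\mathcal B))$, with $\operatorname{unfold}$ stacking frontal slices vertically and $\operatorname{fold}$ its inverse. Transpose: $\mathcal A^\top$ has frontal slices $(A^{(1)})^\top,(A^{(l)})^\top,\dots,(A^{(2)})^\top$. $\mathcal I$ identity tensor, $\mathcal A^{-1}$ t-product inverse. For a symmetric ($\mathcal A=\mathcal A^\top$) tensor that is t-positive definite ($\langle\mathcal Z,\mathcal A*\mathcal Z\rangle>0$ for nonzero $\mathcal Z\in\mathbb R^{p\times1\times l}$), $\mathcal A^{1/2}$ is the unique symmetric t-positive semidefinite $\mathcal S$ with $\mathcal S*\mathcal S=\mathcal A$ and $\mathcal A^{-1/2}=(\mathcal A^{1/2})^{-1}$. $\operatorname{vec}(\mathcal A)$ is the column-major vectorization $\mathcal A(:)$ (columns of $A^{(1)}$, then of $A^{(2)}$, etc.). $[I_p]_{l\times l}$ is the $pl\times pl$ block matrix all of whose $p\times p$ blocks equal $I_p$; for block matrices $M=[M_{ij}]$, $N=[N_{ij}]$ with the same block pattern $l\times l$, the Khatri–Rao product $M\odot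 N$ is the block matrix with $(i,j)$ block $M_{ij}\otimes N_{ij}$. $\dagger$ is the Moore–Penrose inverse. $\mathrm{St}(n,p,l)=\{\mathcal X\in\mathbb R^{n\times p\times l}:\mathcal X^\top*\mathcal X=\mathcal I\}$. *)

(* Defs.v *)
From HB Require Import structures.
From mathcomp Require Import all_boot all_order all_algebra.
From mathcomp Require Import classical_sets boolp reals topology normedtype derive.
Set Implicit Arguments. Unset Strict Implicit. Unset Printing Implicit Defensive.
Import Order.TTheory GRing.Theory Num.Theory.
Import numFieldNormedType.Exports.
Local Open Scope ring_scope.

(* A third-order tensor in R^{n x p x l}: its l frontal slices A^{(k+1)} = A k. *)
Notation tensor R n p l := {ffun 'I_l -> 'M[R]_(n, p)}.

Section Tensors.
Context {R : realType}.

Definition tentry {n p l} (A : tensor R n p l) (a b k : nat) : R :=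
  match (insub a : option 'I_n), (insub b : option 'I_p), (insub k : option 'I_l) with
  | Some a', Some b', Some k' => A k' a' b'
  | _, _, _ => 0
  end.

Definition mxn {m n} (M : 'M[R]_(m, n)) (a b : nat) : R :=
  match (insub a : option 'I_m), (insub b : option 'I_n) with
  | Some a', Some b' => M a' b'
  | _, _ => 0
  end.

(* bcirc(A): block (i,j) is A^{(((i-j) mod l)+1)} *)
Definition bcirc {n p l} (A : tensor R n p l) : 'M[R]_(l * n, l * p) :=
  \matrix_(r, c) tentry A (r %% n) (c %% p) ((r %/ n + l - c %/ p) %% l).

(* bcirc~(A): block (i,j) is A^{(((j-i) mod l)+1)} *)
Definition bcirct {n p l} (A : tensor R n p l) : 'M[R]_(l * n, l * p) :=
  \matrix_(r, c) tentry A (r %% n) (c %% p) ((c %/ p + l - r %/ n) %% l).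

Definition tunfold {p q l} (B : tensor R p q l) : 'M[R]_(l * p, q) :=
  \matrix_(r, c) tentry B (r %% p) c (r %/ p).

Definition tfold {n q l} (M : 'M[R]_(l * n, q)) : tensor R n q l :=
  [ffun k : 'I_l => \matrix_(a < n, b < q) mxn M (k * n + a) b].

Definition tprod {n p q l} (A : tensor R n p l) (B : tensor R p q l) : tensor R n q l :=
  tfold (bcirc A *m tunfold B).

(* transpose: slices (A1)^T, (Al)^T, ..., (A2)^T *)
Definition ttr {n p l} (A : tensor R n p l) : tensor R p n l :=
  [ffun k : 'I_l => \matrix_(a < p, b < n) tentry A b a ((l - k) %% l)].

Definition tI {p l} : tensor R p p l :=
  [ffun k : 'I_l => if val k == 0%N then 1%:M else 0].

Definition tinner {n p l} (A B : tensor R n p l) : R :=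
  \sum_(k < l) \sum_(a < n) \sum_(b < p) A k a b * B k a b.

Definition tsym {p l} (A : tensor R p p l) : Prop := ttr A = A.

Definition tPD {p l} (A : tensor R p p l) : Prop :=
  forall Z : tensor R p 1 l, Z != 0 -> 0 < tinner Z (tprod A Z).

Definition tPSD {p l} (A : tensor R p p l) : Prop :=
  forall Z : tensor R p 1 l, 0 <= tinner Z (tprod A Z).

Definition tinv {p l} (A : tensor R p p l) : tensor R p p l :=
  xget 0 [set B | tprod A B = tI /\ tprod B A = tI].

Definition tsqrt {p l} (A : tensor R p p l) : tensor R p p l :=
  xget 0 [set S | tsym S /\ tPSD S /\ tprod S S = A].

Definition tinvsqrt {p l} (A : tensor R p p l) : tensor R p p l := tinv (tsqrt A).

Definition tStiefel {n p l} (X : tensor R n p l) : Prop := tprod (ttr X) X = tI.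

Definition tTangent {n p l} (X U : tensor R n p l) : Prop :=
  tprod (ttr X) U + tprod (ttr U) X = 0.

Definition tRetr {n p l} (X U : tensor R n p l) : tensor R n p l :=
  tprod (X + U) (tinvsqrt (tI + tprod (ttr U) U)).

(* column-major vectorization A(:) : index a + n*b + n*p*k *)
Definition tvec {n p l} (A : tensor R n p l) : 'cV[R]_(l * n * p) :=
  \matrix_(r, c) tentry A (r %% n) ((r %/ n) %% p) (r %/ (n * p)).

Definition kron {m1 n1 m2 n2} (A : 'M[R]_(m1, n1)) (B : 'M[R]_(m2, n2))
  : 'M[R]_(m1 * m2, n1 * n2) :=
  \matrix_(r, c) (mxn A (r %/ m2) (c %/ n2) * mxn B (r %% m2) (c %% n2)).

(* Khatri-Rao product of l x l block matrices with blocks m1 x n1 and m2 x n2: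
   block (i,j) is M_ij (x) N_ij *)
Definition khatri_rao {l m1 n1 m2 n2} (M : 'M[R]_(l * m1, l * n1))
  (N : 'M[R]_(l * m2, l * n2)) : 'M[R]_(l * m1 * m2, l * n1 * n2) :=
  \matrix_(r, c)
    (let i := (r %/ (m1 * m2))%N in let j := (c %/ (n1 * n2))%N in
     let rr := (r %% (m1 * m2))%N in let cc := (c %% (n1 * n2))%N in
     mxn M (i * m1 + rr %/ m2)%N (j * n1 + cc %/ n2)%N
     * mxn N (i * m2 + rr %% m2)%N (j * n2 + cc %% n2)%N).

(* [I_p]_{l x l}: all p x p blocks equal I_p *)
Definition blockI (l p : nat) : 'M[R]_(l * p, l * p) :=
  \matrix_(r, c) (((r %% p)%N == (c %% p)%N)%:R).

Definition mpinv {m n} (A : 'M[R]_(m, n)) : 'M[R]_(n, m) :=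
  xget 0 [set X | A *m X *m A = A /\ X *m A *m X = X /\
                  (A *m X)^T = A *m X /\ (X *m A)^T = X *m A].

End Tensors.

(* Main.v *)
Require Import Defs.
From HB Require Import structures.
From mathcomp Require Import all_boot all_order all_algebra.
From mathcomp Require Import classical_sets boolp reals topology normedtype derive.
From mathcomp Require Import complex ring lra.
Set Implicit Arguments. Unset Strict Implicit. Unset Printing Implicit Defensive.
Import Order.TTheory GRing.Theory Num.Theory.
Import numFieldNormedType.Exports.
Local Open Scope ring_scope.

(* bcirc is an injective algebra homomorphism compatible with transposition, so
   everything takes place among matrices.  Write P_t = (I + (U+tV)^T (U+tV))^{1/2}
   and Y_t P_t = X + U + tV.  All P_t are >= I, hence the operator
   D |-> D P_t + P D is bounded below in the Frobenius norm.  Applied to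
   D = P_t - P, where D P_t + P D = P_t^2 - P^2 = t A1 + t^2 A2, this gives
   D = O(t).  If P' P + P P' = A1, then E = D - t P' satisfies
   E P + P E = t^2 A2 - D^2, so E = O(t^2), and therefore Y_t - Y = t Y' + O(t^2)
   where Y' P + Y P' = V.  The vectorized equation defining S says
   S P + P S = Y^T V - V^T Y (its matrix is invertible), which makes
   P' = Y^T V - S P the derivative of P_t, and then
   Y' = Y S + (I - Y Y^T) V P^{-1} with P = Y^T (X + U). *)

(** * Square roots and inverses inside a matrix algebra *)

Definition psdmx {R : numDomainType} {n} (A : 'M[R]_n) : Prop :=
  forall v : 'rV_n, 0 <= (v *m A *m v^T) 0 0.

(** Meant for [is_bcirc]: polynomials in a block circulant matrix stay block circulant, which brings
    inverses and square roots back to tensors. *)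
Definition mx_closed {R : pzRingType} {n} (K : 'M[R]_n -> Prop) : Prop :=
  [/\ forall a, K a%:M, forall A B, K A -> K B -> K (A + B)
    & forall A B, K A -> K B -> K (A *m B)].

Lemma mx_closed_horner (R : comNzRingType) n (K : 'M[R]_n.+1 -> Prop)
    (A : 'M[R]_n.+1) (q : {poly R}) :
  mx_closed K -> K A -> K (horner_mx A q).
Proof.
move=> [KC KD KM] KA; elim/poly_ind: q => [|q c IHq].
  rewrite rmorph0; have := KC 0; by rewrite -scalemx1 scale0r.
rewrite rmorphD rmorphM /= horner_mx_X horner_mx_C; apply: KD => //.
exact: KM.
Qed.

(** Cayley-Hamilton: if [char_poly A = q * 'X + c], where [c] is the determinant up to sign, then
    [- c^-1] times [q] evaluated at [A] inverts [A]. *)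
Lemma mx_closed_inv (R : fieldType) n (K : 'M[R]_n -> Prop) (A : 'M[R]_n) :
  mx_closed K -> K A -> A \in unitmx -> K (invmx A).
Proof.
case: n K A => [|n] K A clK KA uA.
  by have [KC _ _] := clK; rewrite (_ : invmx A = 0%:M) // [LHS]flatmx0 [RHS]flatmx0.
have /factor_theorem [q] : root (char_poly A - ((char_poly A)`_0)%:P) 0.
  by rewrite rootE !hornerE horner_coef0 subrr.
rewrite polyC0 subr0 => /(canRL (subrK _)) Eq.
set c := (char_poly A)`_0 in Eq.
have c_neq0 : c != 0.
  rewrite /c char_poly_det mulf_neq0 ?signr_eq0 //.
  by rewrite -unitfE.
have := Cayley_Hamilton A; rewrite Eq rmorphD rmorphM /= horner_mx_X horner_mx_C.
move=> CH.
have -> : invmx A = (- c^-1)%:M *m horner_mx A q.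
  rewrite -[RHS]mulmx1 -(mulmxV uA) mulmxA -[RHS]mul1mx -[X in _ = _ *m X]mulmxA.
  rewrite mulmxA mul1mx -[_ *m _ *m A]mulmxA.
  have -> : horner_mx A q *m A = - c%:M by apply/eqP; rewrite -addr_eq0; apply/eqP.
  by rewrite mulmxN -mulNmx -raddfN opprK -scalar_mxM mulVf // mul1mx.
have [KC _ KM] := clK; apply: KM => //; exact: mx_closed_horner.
Qed.

Lemma trmx_horner (R : comNzRingType) n (A : 'M[R]_n.+1) (q : {poly R}) :
  A^T = A -> (horner_mx A q)^T = horner_mx A q.
Proof.
move=> symA; elim/poly_ind: q => [|q c IHq]; first by rewrite rmorph0 trmx0.
rewrite rmorphD rmorphM /= horner_mx_X horner_mx_C linearD /= tr_scalar_mx.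
rewrite trmx_mul symA IHq; congr (_ + _).
exact/esym/comm_horner_mx.
Qed.

(** Newton interpolation: [m] vanishes on the points of [s], so a multiple of it corrects the value
    at [x] alone. Repeated points are allowed, as eigenvalues may repeat. *)
Lemma poly_interpolation (F : fieldType) (f : F -> F) (s : seq F) :
  exists q : {poly F}, {in s, forall x, q.[x] = f x}.
Proof.
elim: s => [|x s [q Eq]]; first by exists 0.
have [xs|xs] := boolP (x \in s).
  by exists q => y; rewrite inE => /predU1P[->|]; apply: Eq.
pose m := \prod_(y <- s) ('X - y%:P).
have mx_neq0 : m.[x] != 0 by rewrite -rootE root_prod_XsubC.
exists (q + ((f x - q.[x]) / m.[x])%:P * m) => y; rewrite inE !hornerE.
have [-> _|neq_yx /= ys] := eqVneq y x; first by rewrite divfK // addrC subrK.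
have /eqP -> : m.[y] == 0 by rewrite -rootE root_prod_XsubC.
by rewrite mulr0 addr0 Eq.
Qed.

(** * Spectra of real symmetric matrices through complexification *)

Section SymmetricSpectrum.
Local Open Scope sesquilinear_scope.

Lemma spectral_diag_entry (C : numClosedFieldType) n (A : 'M[C]_n) :
  A \is normalmx -> forall i, spectral_diag A 0 i =
    (spectralmx A *m A *m (spectralmx A)^t*) i i.
Proof.
move=> normA i; have /orthomx_spectralP EA := normA.
have PU := spectral_unitarymx A; rewrite invmx_unitary // in EA.
rewrite [X in _ *m X *m _]EA !mulmxA; have /unitarymxP -> := PU.
rewrite mul1mx -mulmxA; have /unitarymxP -> := PU.
by rewrite mulmx1 !mxE eqxx mulr1n.
Qed.

Lemma horner_mx_spectral_diag0 (C : numClosedFieldType) n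
    (A : 'M[C]_n.+1) (q : {poly C}) :
  A \is normalmx -> (forall i, q.[spectral_diag A 0 i] = 0) ->
  horner_mx A q = 0.
Proof.
move=> /orthomx_spectralP EA q0; rewrite EA.
rewrite horner_mx_uconjC; last exact: spectral_unit.
rewrite horner_mx_diag (_ : map_mx _ _ = 0) ?raddf0 ?mulmx0 ?mul0mx //.
by apply/rowP => i; rewrite !mxE.
Qed.

Section RealSymmetric.
Variables (R : rcfType) (n : nat).
Implicit Type A : 'M[R]_n.
Local Notation C := (complex R).
Local Notation toC := (map_mx (@real_complex R)).

Lemma conj_real_complex (x : R) : (x%:C)%C^* = (x%:C)%C.
Proof. by rewrite /= [LHS]conjc_real. Qed.

Lemma toC_hermsym A : A^T = A -> toC A \is hermsymmx.
Proof.
move=> symA; apply/is_hermitianmxP; rewrite expr0 scale1r.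
by apply/matrixP => i j; rewrite !mxE -{1}symA mxE; apply/esym/conj_real_complex.
Qed.

Lemma toC_normal A : A^T = A -> toC A \is normalmx.
Proof. by move=> symA; apply/hermitian_normalmx/toC_hermsym. Qed.

(** The eigenvalue is the Hermitian form of [A] at a row [x + i y] of the diagonalizing unitary
    matrix; its real part is [x A x^T + y A y^T]. *)
Lemma toC_spectral_diag_ge0 A : A^T = A -> psdmx A ->
  forall i, exists2 r : R, 0 <= r & spectral_diag (toC A) 0 i = (r%:C)%C.
Proof.
move=> symA psdA i.
pose P := spectralmx (toC A).
have Ed := spectral_diag_entry (toC_normal symA) i.
have : spectral_diag (toC A) 0 i \is Num.real.
  have /mxOverP := hermitian_spectral_diag_real (toC_hermsym symA).
  exact.
move/Creal_ReP; rewrite -complexRe => Er.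
exists (complex.Re (spectral_diag (toC A) 0 i)) => //.
pose x : 'rV[R]_n := \row_j complex.Re (P i j).
pose y : 'rV[R]_n := \row_j complex.Im (P i j).
suff -> : complex.Re (spectral_diag (toC A) 0 i) =
    (x *m A *m x^T) 0 0 + (y *m A *m y^T) 0 0 by rewrite addr_ge0.
rewrite Ed !mxE raddf_sum -big_split /=; apply: eq_bigr => k _.
rewrite !mxE !mulr_suml raddf_sum -big_split /=; apply: eq_bigr => j _.
rewrite !mxE; case: (P i j) => a b; case: (P i k) => c d /=; ring.
Qed.

End RealSymmetric.

Lemma horner_mx_spectral0 (R : rcfType) n (A : 'M[R]_n.+1) (q : {poly R}) :
  A^T = A ->
  (forall i r, spectral_diag (map_mx (@real_complex R) A) 0 i = (r%:C)%C ->
     q.[r] = 0) ->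
  psdmx A -> horner_mx A q = 0.
Proof.
move=> symA q0 psdA.
set AC := map_mx (@real_complex R) A.
apply: (@map_mx_inj _ _ (@real_complex R)).
rewrite map_mx0 map_horner_mx.
apply: horner_mx_spectral_diag0 (toC_normal symA) _ => i.
have [r _ Er] := toC_spectral_diag_ge0 symA psdA i.
by rewrite Er horner_map /= (q0 _ _ Er).
Qed.

End SymmetricSpectrum.

(* S is the polynomial in A that interpolates the square root on the spectrum,
   so every algebra containing A contains S; S is positive as it is the square
   of the polynomial that interpolates the fourth root. *)
Lemma psdmx_sqrt (R : rcfType) n (K : 'M[R]_n -> Prop) (A : 'M[R]_n) :
  mx_closed K -> K A -> A^T = A -> psdmx A ->
  exists S, [/\ K S, S^T = S, psdmx S & S *m S = A].
Proof.
case: n K A => [|n] K A clK KA symA psdA.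
  exists A; split=> //; by rewrite [LHS]flatmx0 [RHS]flatmx0.
pose f (x : R) := Num.sqrt (Num.sqrt x).
pose AC := map_mx (@real_complex R) A.
have [q Eq] := poly_interpolation f
  [seq complex.Re (spectral_diag AC 0 i) | i <- enum 'I_n.+1].
have symq := trmx_horner q symA.
exists (horner_mx A q *m horner_mx A q); split.
- by have [_ _ KM] := clK; apply: KM; apply: mx_closed_horner.
- by rewrite trmx_mul !symq.
- move=> v; rewrite !mulmxA -{2}symq -mulmxA -trmx_mul mxE sumr_ge0 // => k _.
  by rewrite [_^T _ _]mxE -expr2 sqr_ge0.
have := @horner_mx_spectral0 _ _ A (q * q * (q * q) - 'X) symA.
rewrite rmorphB !rmorphM /= horner_mx_X => q0; apply/eqP; rewrite -subr_eq0.
apply/eqP/q0 => // i r Er.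
have [r' r'_ge0] := toC_spectral_diag_ge0 symA psdA i.
rewrite Er => -[?]; subst r'.
have Eqr : q.[r] = f r.
  by apply: Eq; apply/mapP; exists i; rewrite ?mem_enum //= Er.
rewrite !hornerE Eqr /f /= -mulrA -!expr2.
by rewrite !sqr_sqrtr ?sqrtr_ge0 // subrr.
Qed.

(** * Sylvester equations and asymptotic estimates *)

(** This is the Frobenius inner product; [\tr (A *m A^T)] serves as the squared norm below. *)
Lemma mxtrace_mul_tr (R : comPzRingType) m n (A B : 'M[R]_(m, n)) :
  \tr (A *m B^T) = \sum_i \sum_j A i j * B i j.
Proof.
by apply: eq_bigr => i _; rewrite mxE; apply: eq_bigr => j _; rewrite mxE.
Qed.

Lemma mxtrace_mul_tr_ge0 (R : realDomainType) m n (A : 'M[R]_(m, n)) :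
  0 <= \tr (A *m A^T).
Proof.
rewrite mxtrace_mul_tr !sumr_ge0 // => i _; rewrite sumr_ge0 // => j _.
by rewrite -expr2 sqr_ge0.
Qed.

Lemma sqr_entry_le_mxtrace (R : realDomainType) m n (A : 'M[R]_(m, n)) i j :
  A i j ^+ 2 <= \tr (A *m A^T).
Proof.
rewrite mxtrace_mul_tr (bigD1 i) //= (bigD1 j) //= -expr2 -addrA lerDl.
by rewrite addr_ge0 ?sumr_ge0 // => k _; rewrite ?sumr_ge0 // => *; rewrite -expr2 sqr_ge0.
Qed.

Lemma psdmx_mxtrace (R : numDomainType) m n (A : 'M[R]_n) (D : 'M[R]_(m, n)) :
  psdmx A -> 0 <= \tr (D *m A *m D^T).
Proof.
move=> psdA; apply: sumr_ge0 => i _.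
have -> : (D *m A *m D^T) i i = (row i D *m A *m (row i D)^T) 0 0; last exact: psdA.
by rewrite -row_mul tr_row !mxE; apply: eq_bigr => k _; rewrite !mxE.
Qed.

Lemma psdmx_sub1_trace (R : numDomainType) m n (A : 'M[R]_n) (D : 'M[R]_(m, n)) :
  psdmx (A - 1%:M) -> \tr (D *m D^T) <= \tr (D *m A *m D^T).
Proof.
move=> /(psdmx_mxtrace D).
by rewrite mulmxBr mulmx1 mulmxBl linearB /= subr_ge0.
Qed.

(** A row in the kernel has [v A = - v], so [v A v^T = - v v^T], and positivity of [A] forces
    [v = 0]. *)
Lemma psdmx_add1_unit (R : realFieldType) n (A : 'M[R]_n) :
  psdmx A -> A + 1%:M \in unitmx.
Proof.
move=> psdA; rewrite -row_free_unit; apply: inj_row_free => v.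
rewrite mulmxDr mulmx1 => vA; apply/rowP => j; rewrite mxE.
have := psdA v; move/eqP: vA; rewrite addr_eq0 => /eqP->; rewrite mulNmx mxE.
rewrite oppr_ge0 => v_le0; apply/eqP; rewrite -sqrf_eq0 eq_le sqr_ge0 andbT.
by have := sqr_entry_le_mxtrace v 0 j; rewrite /mxtrace big_ord1 => /le_trans; apply.
Qed.

(* Substituting v = w (P + 1) turns v (P - 1) v^T into
   w (P^2 - 1) w^T + (w Q) (P^2 - 1) (w Q)^T where Q^2 = P. *)
Lemma psdmx_sub1_sqrt (R : rcfType) n (P : 'M[R]_n) :
  P^T = P -> psdmx P -> psdmx (P *m P - 1%:M) -> psdmx (P - 1%:M).
Proof.
move=> symP psdP psdPP v.
have [Q [_ symQ _ QQ]] : exists Q, [/\ True, Q^T = Q, psdmx Q & Q *m Q = P].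
  by apply: (@psdmx_sqrt _ _ (fun=> True)) => //; split.
have trP1 : (P + 1%:M)^T = P + 1%:M by rewrite linearD /= symP tr_scalar_mx.
have uP := psdmx_add1_unit psdP.
have [w ->] : exists w, v = w *m (P + 1%:M).
  by exists (v *m invmx (P + 1%:M)); rewrite mulmxKV.
have -> : w *m (P + 1%:M) *m (P - 1%:M) *m (w *m (P + 1%:M))^T =
  w *m (P *m P - 1%:M) *m w^T + (w *m Q) *m (P *m P - 1%:M) *m (w *m Q)^T.
  rewrite !trmx_mul symQ trP1 !mulmxA -!mulmxDl.
  rewrite -!(mulmxA w) -!mulmxDr.
  rewrite -[RHS]mulmxA; congr (_ *m (_ *m _)).
  rewrite !(mulmxDl, mulmxDr, mulmxN, mulNmx, mulmx1, mul1mx).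
  have -> : Q *m (P *m P) *m Q = P *m P *m P by rewrite -!QQ !mulmxA.
  rewrite QQ; move: (P *m P *m P) (P *m P) => P3 P2.
  by apply/matrixP => i j; rewrite !mxE; ring.
by rewrite mxE addr_ge0.
Qed.

(* Pairing the equation with D in the trace inner product. *)
Lemma sylvester_bound (R : realFieldType) n (P P' D W : 'M[R]_n) :
  psdmx (P - 1%:M) -> psdmx (P' - 1%:M) -> D *m P' + P *m D = W ->
  \tr (D *m D^T) <= \tr (W *m W^T).
Proof.
move=> psdP psdP' EW.
have h1 := psdmx_sub1_trace D psdP'; have h2 := psdmx_sub1_trace D^T psdP.
have EWD : \tr (W *m D^T) = \tr (D *m P' *m D^T) + \tr (D^T *m P *m D^T^T).
  by rewrite -EW mulmxDl linearD /= trmxK -[D^T *m P *m D]mulmxA [in RHS](mxtrace_mulC D^T).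
(* Positivity of [|D - W|^2] replaces Cauchy-Schwarz: [h1], [h2] and [EWD] give [<W, D> >= 2 |D|^2],
   hence [3 |D|^2 <= |W|^2]. *)
have := mxtrace_mul_tr_ge0 (D - W).
rewrite linearB /= mulmxBl !mulmxBr !linearB /=.
have -> : \tr (D *m W^T) = \tr (W *m D^T) by rewrite -mxtrace_tr trmx_mul trmxK.
have := mxtrace_mul_tr_ge0 D.
rewrite trmxK [\tr (D^T *m D)]mxtrace_mulC in h2.
rewrite trmxK in EWD.
lra.
Qed.

(** Lets a right factor [P] be cancelled from an estimate with constant 1, uniformly in [P]. *)
Lemma mxtrace_mul_ge (R : numDomainType) m n (P : 'M[R]_n) (D : 'M[R]_(m, n)) :
  P^T = P -> psdmx (P *m P - 1%:M) ->
  \tr (D *m D^T) <= \tr ((D *m P) *m (D *m P)^T).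
Proof.
move=> symP /(psdmx_sub1_trace D).
by rewrite trmx_mul symP !mulmxA.
Qed.

(** The interval [|t| <= 1] is fixed, so bounds combine without shrinking neighbourhoods. No sign is
    imposed on [c]; proofs pass to [|c|] where monotonicity needs it. *)
Definition mxO {R : numDomainType} {m n} (k : nat) (F : R -> 'M[R]_(m, n)) :=
  exists c, forall t, `|t| <= 1 -> forall i j, `|F t i j| <= c * `|t| ^+ k.

Section MxO.
Variable R : realType.

Lemma mxO_monomial m n k (A : 'M[R]_(m, n)) : mxO k (fun t => t ^+ k *: A).
Proof.
exists (\sum_i \sum_j `|A i j|) => t _ i j; rewrite mxE normrM normrX mulrC.
apply: ler_wpM2r; first exact: exprn_ge0.
rewrite (bigD1 i) //= (bigD1 j) //= -addrA lerDl.
by rewrite addr_ge0 ?sumr_ge0 // => *; rewrite sumr_ge0.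
Qed.

Lemma mxO_cst m n (A : 'M[R]_(m, n)) : mxO 0 (fun=> A).
Proof. by have := mxO_monomial 0 A; under eq_fun do rewrite expr0 scale1r. Qed.

Lemma mxOD m n k (F G : R -> 'M[R]_(m, n)) :
  mxO k F -> mxO k G -> mxO k (fun t => F t + G t).
Proof.
move=> [c Fc] [d Gd]; exists (c + d) => t t1 i j; rewrite mxE mulrDl.
by apply: le_trans (ler_normD _ _) _; rewrite lerD ?Fc ?Gd.
Qed.

Lemma mxON m n k (F : R -> 'M[R]_(m, n)) : mxO k F -> mxO k (fun t => - F t).
Proof. by move=> [c Fc]; exists c => t t1 i j; rewrite mxE normrN Fc. Qed.

Lemma mxOB m n k (F G : R -> 'M[R]_(m, n)) :
  mxO k F -> mxO k G -> mxO k (fun t => F t - G t).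
Proof. by move=> OF OG; apply: mxOD => //; apply: mxON. Qed.

Lemma mxOM m n p k l (F : R -> 'M[R]_(m, n)) (G : R -> 'M[R]_(n, p)) :
  mxO k F -> mxO l G -> mxO (k + l) (fun t => F t *m G t).
Proof.
move=> [c Fc] [d Gd]; exists (n%:R * (c * d)) => t t1 i j; rewrite mxE.
apply: le_trans (ler_norm_sum _ _ _) _.
have -> : n%:R * (c * d) * `|t| ^+ (k + l) =
    \sum_(s < n) c * `|t| ^+ k * (d * `|t| ^+ l).
  by rewrite sumr_const card_ord -mulr_natl exprD; ring.
by apply: ler_sum => s _; rewrite normrM ler_pM ?Fc ?Gd.
Qed.

Lemma mxO_lower m n k (F : R -> 'M[R]_(m, n)) : mxO k.+1 F -> mxO k F.
Proof.
move=> [c Fc]; exists `|c| => t t1 i j; apply: le_trans (Fc t t1 i j) _.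
apply: (@le_trans _ _ (`|c| * `|t| ^+ k.+1)).
  by apply: ler_wpM2r; rewrite ?exprn_ge0 ?ler_norm.
apply: ler_wpM2l => //; rewrite exprS ler_piMl ?exprn_ge0 //.
Qed.

(** Bridge from Frobenius estimates, such as [sylvester_bound], to the entrywise orders of [mxO]. *)
Lemma mxO_mxtrace m n p q k (F : R -> 'M[R]_(m, n)) (G : R -> 'M[R]_(p, q)) :
  (forall t, \tr (F t *m (F t)^T) <= \tr (G t *m (G t)^T)) ->
  mxO k G -> mxO k F.
Proof.
(* The squared norm of [G t] sums [p * q] squared entries; [N <= (N + 1)^2] avoids the square root
   of [N = p * q]. *)
move=> FG [c Gc]; exists (((p * q)%N%:R + 1) * `|c|) => t t1 i j.
set N : R := (p * q)%N%:R; set x := `|c| * `|t| ^+ k.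
have x_ge0 : 0 <= x by rewrite mulr_ge0 ?exprn_ge0.
have Gx i' j' : G t i' j' * G t i' j' <= x ^+ 2.
  rewrite -expr2 -real_normK ?num_real // ler_sqr ?nnegrE //.
  apply: le_trans (Gc t t1 i' j') _.
  by apply: ler_wpM2r; rewrite ?exprn_ge0 ?ler_norm.
have Fx : F t i j ^+ 2 <= N * x ^+ 2.
  apply: le_trans (sqr_entry_le_mxtrace _ i j) _; apply: le_trans (FG t) _.
  rewrite mxtrace_mul_tr.
  have -> : N * x ^+ 2 = \sum_(i' < p) \sum_(j' < q) x ^+ 2.
    by rewrite !sumr_const !card_ord -mulrnA -mulr_natl /N mulnC.
  by apply: ler_sum => i' _; apply: ler_sum => j' _.
have N0 : 0 <= N by rewrite ler0n.
rewrite -mulrA -/x -(@ler_sqr R) ?nnegrE ?mulr_ge0 ?addr_ge0 ?exprn_ge0 //.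
rewrite real_normK ?num_real // exprMn; apply: le_trans Fx _.
apply: ler_wpM2r; first exact: sqr_ge0.
nra.
Qed.

Lemma is_derive_quadratic (f : R -> R) (y d : R) (c : R) :
  (forall t, `|t| <= 1 -> `|f t - y - t * d| <= c * `|t| ^+ 2) ->
  is_derive (0 : R) (1 : R) f d.
Proof.
move=> H.
(* At [t = 0] the bound has right side zero, which identifies [y] with [f 0]. *)
have f0 : f 0 = y.
  have := H 0; rewrite normr0 ler01 expr2 !(mul0r, mulr0, subr0) => /(_ isT).
  by rewrite normr_le0 subr_eq0 => /eqP.
pose g (h : R) : R := h^-1 *: ((f \o shift 0) (h *: 1) - f 0).
have cv : (g h @[h --> 0^'] --> d)%classic.
  apply/cvgrPdist_le => e e0.
  near=> h.
  have h0 : h != 0 by near: h; exact: nbhs_dnbhs_neq.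
  have h1 : `|h| <= 1 by near: h; apply: dnbhs0_le.
  (* The divisor [|c| + 1] is positive whatever [c] is. *)
  have he : `|h| <= e / (`|c| + 1) by near: h; apply: dnbhs0_le; rewrite divr_gt0 // ltr_wpDl.
  rewrite /g /= addr0 [_ *: 1]mulr1 f0 distrC.
  have -> : h^-1 *: (f h - y) - d = h^-1 * (f h - y - h * d).
    by rewrite [RHS]mulrBr mulKf.
  rewrite normrM normfV ler_pdivrMl ?normr_gt0 //.
  apply: le_trans (H h h1) _; rewrite expr2 mulrC -mulrA.
  apply: ler_wpM2l => //.
  move: he; rewrite ler_pdivlMr ?ltr_wpDl //; apply: le_trans.
  apply: ler_wpM2l => //; apply: le_trans (ler_norm c) _; lra.
by split; [apply/cvg_ex; exists d | apply: cvg_lim].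
Unshelve. all: by end_near.
Qed.

End MxO.

(** * First-order expansion of the two polar factors *)

Section PolarDerivative.
Variables (R : realType) (m n : nat) (A1 A2 P P' : 'M[R]_n) (Pt : R -> 'M[R]_n).
Hypothesis symPt : forall t, (Pt t)^T = Pt t.
Hypothesis Pt_ge1 : forall t, psdmx (Pt t - 1%:M).
Hypothesis P_ge1 : psdmx (P - 1%:M).
Hypothesis PtPt : forall t, Pt t *m Pt t = P *m P + t *: A1 + t ^+ 2 *: A2.
Hypothesis lyapP' : P' *m P + P *m P' = A1.

Lemma mxsqrt_lipschitz : mxO 1 (fun t => Pt t - P).
Proof.
apply: (@mxO_mxtrace _ _ _ _ _ _ _ (fun t => t ^+ 1 *: A1 + t ^+ 2 *: A2)).
  (* The two coefficients differ: [D = Pt t - P] satisfies [D (Pt t) + P D = (Pt t)^2 - P^2], with a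
     bound uniform in [t]. *)
  move=> t; apply: (sylvester_bound P_ge1 (Pt_ge1 t)).
  rewrite mulmxBl mulmxBr PtPt expr1.
  by apply/matrixP => i j; rewrite !mxE; ring.
by apply: mxOD; first exact: mxO_monomial; apply/mxO_lower/mxO_monomial.
Qed.

Lemma mxsqrt_expansion : mxO 2 (fun t => Pt t - P - t *: P').
Proof.
apply: (@mxO_mxtrace _ _ _ _ _ _ _
  (fun t => t ^+ 2 *: A2 - (Pt t - P) *m (Pt t - P))).
  move=> t; apply: (sylvester_bound P_ge1 P_ge1).
  rewrite !(mulmxBl, mulmxBr) PtPt -lyapP' -!scalemxAl -!scalemxAr.
  move: (P *m P) (Pt t *m P) (P *m Pt t) (P' *m P) (P *m P') => M1 M2 M3 M4 M5.
  by apply/matrixP => i j; rewrite !mxE; ring.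
apply: mxOB; first exact: mxO_monomial.
by have := mxOM mxsqrt_lipschitz mxsqrt_lipschitz.
Qed.

Hypothesis PtPt_ge1 : forall t, psdmx (Pt t *m Pt t - 1%:M).

(** The inverse of [Pt t] is never expanded: the remainder of [Yt t] times [Pt t] is second order by
    the two lemmas above, and [mxtrace_mul_ge] removes the factor. *)
Lemma polar_expansion (Y Y' V : 'M[R]_(m, n)) (Yt : R -> 'M[R]_(m, n)) :
  (forall t, Yt t *m Pt t = Y *m P + t *: V) -> Y' *m P + Y *m P' = V ->
  mxO 2 (fun t => Yt t - Y - t *: Y').
Proof.
move=> YtPt EV.
apply: (@mxO_mxtrace _ _ _ _ _ _ _
  (fun t => - (Y *m (Pt t - P - t *: P')) - (t ^+ 1 *: Y') *m (Pt t - P))).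
  move=> t; apply: le_trans (mxtrace_mul_ge _ (symPt t) (PtPt_ge1 t)) _.
  have -> // : (Yt t - Y - t *: Y') *m Pt t =
    - (Y *m (Pt t - P - t *: P')) - (t ^+ 1 *: Y') *m (Pt t - P).
  rewrite !(mulmxBl, mulmxBr) YtPt -EV -!scalemxAl -!scalemxAr expr1.
  move: (Y *m P) (Y *m Pt t) (Y' *m Pt t) (Y' *m P) (Y *m P') => M1 M2 M3 M4 M5.
  by apply/matrixP => i j; rewrite !mxE; ring.
apply: mxOB.
  by apply/mxON; have := mxOM (mxO_cst Y) mxsqrt_expansion.
by have := mxOM (mxO_monomial 1 Y') mxsqrt_lipschitz.
Qed.

End PolarDerivative.

(** * Tensors as block circulant matrices *)

Section BlockIndex.
Variables l n : nat.

Lemma bidx_subproof (k : 'I_l) (a : 'I_n) : (k * n + a < l * n)%N.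
Proof.
have h : (k.+1 * n <= l * n)%N by rewrite leq_mul2r ltn_ord orbT.
by apply: leq_trans h; rewrite mulSn addnC ltn_add2r ltn_ord.
Qed.

(* Row a of block k. *)
Definition bidx k a : 'I_(l * n) := Ordinal (bidx_subproof k a).

Lemma bidx_divn k a : (bidx k a %/ n)%N = k.
Proof. by rewrite /= divnMDl ?divn_small ?addn0 // (leq_ltn_trans _ (ltn_ord a)). Qed.

Lemma bidx_modn k a : (bidx k a %% n)%N = a.
Proof. by rewrite /= modnMDl modn_small. Qed.

Lemma bidx_bij : bijective (fun x : 'I_l * 'I_n => bidx x.1 x.2).
Proof.
apply: inj_card_bij; last by rewrite card_prod !card_ord.
move=> [k a] [k' a'] /= E; congr (_, _); apply: val_inj => /=.
  by rewrite -[LHS](bidx_divn k a) E bidx_divn.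
by rewrite -[LHS](bidx_modn k a) E bidx_modn.
Qed.

Lemma bidxP (r : 'I_(l * n)) : exists k a, r = bidx k a.
Proof. by have [f _ fK] := bidx_bij; exists (f r).1, (f r).2; rewrite fK. Qed.

Lemma big_bidx (V : nmodType) (F : 'I_(l * n) -> V) :
  \sum_r F r = \sum_k \sum_a F (bidx k a).
Proof.
by rewrite pair_big (reindex _ (onW_bij _ bidx_bij)).
Qed.

End BlockIndex.

Section Entries.
Variable R : realType.

Lemma tentryE n p l (A : tensor R n p l) (a : 'I_n) (b : 'I_p) (k : 'I_l) :
  tentry A a b k = A k a b.
Proof. by rewrite /tentry !valK. Qed.

Lemma mxnE m n (M : 'M[R]_(m, n)) (a : 'I_m) (b : 'I_n) : mxn M a b = M a b.
Proof. by rewrite /mxn !valK. Qed.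

Lemma tensorP n p l (A B : tensor R n p l) :
  (forall k a b, A k a b = B k a b) -> A = B.
Proof. by move=> E; apply/ffunP => k; apply/matrixP. Qed.

Lemma tensorDE n p l (A B : tensor R n p l) k a b :
  (A + B) k a b = A k a b + B k a b.
Proof. by rewrite ffunE mxE. Qed.

Lemma tensorNE n p l (A : tensor R n p l) k a b : (- A) k a b = - A k a b.
Proof. by rewrite ffunE mxE. Qed.

Lemma tensorZE n p l c (A : tensor R n p l) k a b : (c *: A) k a b = c * A k a b.
Proof. by rewrite ffunE mxE. Qed.

Lemma tensor0E n p l k a b : (0 : tensor R n p l) k a b = 0.
Proof. by rewrite ffunE mxE. Qed.

Lemma tunfoldE n p l (A : tensor R n p l) k a b :
  tunfold A (bidx k a) b = A k a b.
Proof. by rewrite mxE bidx_divn bidx_modn tentryE. Qed.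

Lemma tfoldE n p l (M : 'M[R]_(l * n, p)) k a b :
  tfold M k a b = M (bidx k a) b.
Proof. by rewrite ffunE mxE -[(k * n + a)%N]/(val (bidx k a)) mxnE. Qed.

Lemma tfoldK n p l (M : 'M[R]_(l * n, p)) : tunfold (tfold M) = M.
Proof.
apply/matrixP => r b; have [k [a ->]] := bidxP r.
by rewrite tunfoldE tfoldE.
Qed.

Lemma tunfold_tprod n p q l (A : tensor R n p l) (B : tensor R p q l) :
  tunfold (tprod A B) = bcirc A *m tunfold B.
Proof. exact: tfoldK. Qed.

Lemma tvecE p l (A : tensor R p p l) k a b :
  tvec A (bidx (bidx k b) a) 0 = A k a b.
Proof.
rewrite mxE bidx_modn divnMA !bidx_divn.
have -> : (nat_of_ord (bidx k b) %% p)%N = b by exact: bidx_modn.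
by rewrite tentryE.
Qed.

Lemma tvec_inj p l : injective (@tvec R p p l).
Proof.
move=> A B E; apply: tensorP => k a b.
by rewrite -!tvecE E.
Qed.

Lemma tvec_surj p l (v : 'cV[R]_(l * p * p)) :
  exists A : tensor R p p l, v = tvec A.
Proof.
exists [ffun k => \matrix_(a, b) v (bidx (bidx k b) a) 0].
apply/colP => r; have [r' [a ->]] := bidxP r; have [k [b ->]] := bidxP r'.
by rewrite tvecE ffunE mxE.
Qed.

Lemma kronE m1 n1 m2 n2 (A : 'M[R]_(m1, n1)) (B : 'M[R]_(m2, n2)) i j a b :
  kron A B (bidx i a) (bidx j b) = A i j * B a b.
Proof. by rewrite mxE !bidx_divn !bidx_modn !mxnE. Qed.

Lemma khatri_raoE l m1 n1 m2 n2 (M : 'M[R]_(l * m1, l * n1))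
    (N : 'M[R]_(l * m2, l * n2)) i j a1 a2 b1 b2 :
  khatri_rao M N (bidx (bidx i a1) a2) (bidx (bidx j b1) b2) =
  M (bidx i a1) (bidx j b1) * N (bidx i a2) (bidx j b2).
Proof.
(* Decodes a flat index into block, outer and inner positions; [m * m'] is positive because the
   ordinals [a] and [a'] exist. *)
have E k m m' (i' : 'I_k) (a : 'I_m) (a' : 'I_m') :
    ((bidx (bidx i' a) a' %/ (m * m') = i')%N *
     ((bidx (bidx i' a) a' %% (m * m')) %/ m' = a)%N *
     ((bidx (bidx i' a) a' %% (m * m')) %% m' = a')%N)%type.
  have -> : (nat_of_ord (bidx (bidx i' a) a') = i' * (m * m') + bidx a a')%N.
    by rewrite /= mulnDl mulnA addnA.
  rewrite modnMDl divnMDl; last by case: m a => [[]|m _] //; case: m' a' => [[]|].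
  by rewrite modn_small // divn_small // addn0 bidx_divn bidx_modn.
rewrite mxE; cbv zeta; rewrite !E.
rewrite -[(i * m1 + a1)%N]/(val (bidx i a1)) -[(j * n1 + b1)%N]/(val (bidx j b1)).
by rewrite -[(i * m2 + a2)%N]/(val (bidx i a2)) -[(j * n2 + b2)%N]/(val (bidx j b2)) !mxnE.
Qed.

Lemma blockIE l p i j (a b : 'I_p) :
  (blockI l p : 'M[R]_(l * p)) (bidx i a) (bidx j b) = (a == b)%:R.
Proof. by rewrite mxE !bidx_modn. Qed.

End Entries.

(** * The algebra embedding [bcirc] and the vectorized Lyapunov operator *)

Section Bcirc.
Variables (R : realType) (l' : nat).
Local Notation l := l'.+1.

(** A positive number of slices makes ['I_l] the group Z/l, whose subtraction is the modular index
    arithmetic of the definitions. *)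
Lemma val_subZp (i j : 'I_l) : ((i + l - j) %% l)%N = val (i - j).
Proof. by rewrite /= modnDmr addnBA // ltnW. Qed.

Lemma bcircE n p (A : tensor R n p l) i j a b :
  bcirc A (bidx i a) (bidx j b) = A (i - j) a b.
Proof. by rewrite mxE !bidx_divn !bidx_modn val_subZp tentryE. Qed.

Lemma bcirctE n p (A : tensor R n p l) i j a b :
  bcirct A (bidx i a) (bidx j b) = A (j - i) a b.
Proof. by rewrite mxE !bidx_divn !bidx_modn val_subZp tentryE. Qed.

Lemma ttrE n p (A : tensor R n p l) k a b : ttr A k a b = A (- k) b a.
Proof. by rewrite ffunE mxE -[((l - k) %% l)%N]/(val (- k)) tentryE. Qed.

Lemma tIE p (k : 'I_l) (a b : 'I_p) : (tI k a b : R) = ((k == 0) && (a == b))%:R.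
Proof.
rewrite ffunE -[val k == 0%N]/(k == 0).
by case: (k == 0); rewrite ?mxE //.
Qed.

Lemma tprodE n p q (A : tensor R n p l) (B : tensor R p q l) k a b :
  tprod A B k a b = \sum_j \sum_c A (k - j) a c * B j c b.
Proof.
rewrite tfoldE mxE big_bidx; apply: eq_bigr => j _; apply: eq_bigr => c _.
by rewrite bcircE tunfoldE.
Qed.

Lemma bcircP n p (M N : 'M[R]_(l * n, l * p)) :
  (forall i a j b, M (bidx i a) (bidx j b) = N (bidx i a) (bidx j b)) -> M = N.
Proof.
move=> E; apply/matrixP => r c.
by have [i [a ->]] := bidxP r; have [j [b ->]] := bidxP c.
Qed.

Lemma bcirc_inj n p : injective (@bcirc R n p l).
Proof.
move=> A B E; apply: tensorP => k a b.
by rewrite -[k]subr0 -!bcircE E.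
Qed.

Lemma bcircM n p q (A : tensor R n p l) (B : tensor R p q l) :
  bcirc (tprod A B) = bcirc A *m bcirc B.
Proof.
apply: bcircP => i a j b; rewrite bcircE tprodE mxE big_bidx.
(* Replacing [k] by [k - j] turns the cyclic convolution into the block product. *)
rewrite (reindex_inj (subIr j)) /=; apply: eq_bigr => k _; apply: eq_bigr => c _.
by rewrite !bcircE opprB addrA subrK.
Qed.

Lemma bcircD n p (A B : tensor R n p l) : bcirc (A + B) = bcirc A + bcirc B.
Proof. by apply: bcircP => i a j b; rewrite [RHS]mxE !bcircE tensorDE. Qed.

Lemma bcircN n p (A : tensor R n p l) : bcirc (- A) = - bcirc A.
Proof. by apply: bcircP => i a j b; rewrite [RHS]mxE !bcircE tensorNE. Qed.

Lemma bcircZ n p c (A : tensor R n p l) : bcirc (c *: A) = c *: bcirc A.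
Proof. by apply: bcircP => i a j b; rewrite [RHS]mxE !bcircE tensorZE. Qed.

Lemma bcirc0 n p : bcirc (0 : tensor R n p l) = 0.
Proof. by apply: bcircP => i a j b; rewrite [RHS]mxE !bcircE tensor0E. Qed.

Lemma bcirc_tr n p (A : tensor R n p l) : bcirc (ttr A) = (bcirc A)^T.
Proof. by apply: bcircP => i a j b; rewrite [RHS]mxE !bcircE ttrE opprB. Qed.

Lemma bcircI p : bcirc (tI : tensor R p p l) = 1%:M.
Proof.
apply: bcircP => i a j b; rewrite [RHS]mxE !bcircE tIE subr_eq0.
by rewrite -[LHS]/(((i, a) == (j, b))%:R) -(inj_eq (bij_inj (@bidx_bij l p)) (i, a) (j, b)).
Qed.

Definition bcircS := (bcircM, bcircD, bcircN, bcircZ, bcirc_tr, bcircI).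

Definition is_bcirc p (M : 'M[R]_(l * p)) :=
  exists A : tensor R p p l, M = bcirc A.

Lemma is_bcirc_closed p : mx_closed (@is_bcirc p).
Proof.
split=> [c|_ _ [A ->] [B ->]|_ _ [A ->] [B ->]].
- by exists (c *: tI); rewrite bcircZ bcircI scalemx1.
- by exists (A + B); rewrite bcircD.
- by exists (tprod A B); rewrite bcircM.
Qed.

Lemma tinner_tprod p (A : tensor R p p l) (Z : tensor R p 1 l) :
  tinner Z (tprod A Z) = ((tunfold Z)^T *m bcirc A *m tunfold Z) 0 0.
Proof.
rewrite -mulmxA -tunfold_tprod mxE big_bidx.
apply: eq_bigr => k _; apply: eq_bigr => a _.
by rewrite big_ord1 !mxE ?bidx_divn ?bidx_modn -!tunfoldE !mxE bidx_divn bidx_modn.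
Qed.

(** Every vector is the unfolding of a one-column tensor, so the two quadratic forms take the same
    values. *)
Lemma tPSDP p (A : tensor R p p l) : tPSD A <-> psdmx (bcirc A).
Proof.
split=> [psdA v|psdA Z]; last first.
  by rewrite tinner_tprod -{2}[tunfold Z]trmxK; apply: psdA.
have := psdA (tfold v^T); rewrite tinner_tprod tfoldK trmxK; exact.
Qed.

(** The matrix inverse is block circulant by [mx_closed_inv], hence comes from a tensor, the only
    candidate [xget] can choose. *)
Lemma tinvP p (A : tensor R p p l) :
  bcirc A \in unitmx -> bcirc (tinv A) = invmx (bcirc A).
Proof.
move=> uA.
have [B EB] := mx_closed_inv (is_bcirc_closed p) (ex_intro _ A erefl) uA.
suff -> : tinv A = B by [].
apply: xget_unique => [|C [AC _]].
  by split; apply: bcirc_inj; rewrite bcircM bcircI -EB ?mulmxV ?mulVmx.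
apply: bcirc_inj; rewrite -EB -[LHS](mulKmx uA) -bcircM AC bcircI mulmx1 //.
Qed.

(** The root from [psdmx_sqrt] is block circulant, so the set given to [xget] is inhabited and the
    chosen value has its defining properties. *)
Lemma tsqrtP p (A : tensor R p p l) :
  (bcirc A)^T = bcirc A -> psdmx (bcirc A) ->
  [/\ (bcirc (tsqrt A))^T = bcirc (tsqrt A), psdmx (bcirc (tsqrt A))
    & bcirc (tsqrt A) *m bcirc (tsqrt A) = bcirc A].
Proof.
move=> symA psdA.
have [_ [[S ->] symS psdS SS]] :=
  psdmx_sqrt (is_bcirc_closed p) (ex_intro _ A erefl) symA psdA.
have /(xgetPex 0) [] : exists S, [set S | tsym S /\ tPSD S /\ tprod S S = A]%classic S.
  exists S; split; first by apply: bcirc_inj; rewrite bcirc_tr.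
  split; first exact/tPSDP.
  by apply: bcirc_inj; rewrite bcircM.
rewrite -/(tsqrt A) => symT [/tPSDP psdT TT]; split=> //.
  by rewrite -bcirc_tr symT.
by rewrite -bcircM TT.
Qed.

(** The Kronecker term encodes [T * P], which fixes the row index inside a slice; the Khatri-Rao
    term encodes [P * T], which fixes the column index, whence the identity blocks. *)
Lemma lyapunov_vec p (P T : tensor R p p l) :
  (kron (bcirct P)^T (1%:M : 'M[R]_p) +
     khatri_rao (blockI l p : 'M[R]_(l * p)) (bcirc P)) *m tvec T =
  tvec (tprod T P + tprod P T).
Proof.
apply/colP => r; have [r' [a ->]] := bidxP r; have [k [b ->]] := bidxP r'.
rewrite tvecE tensorDE !tprodE mulmxDl [LHS]mxE; congr (_ + _).
  rewrite mxE !big_bidx (reindex_inj (can_inj (subKr k))) /=.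
  apply: eq_bigr => j _; apply: eq_bigr => c _; rewrite (bigD1 a) //=.
  rewrite big1 ?addr0 => [|d ad]; last first.
    by rewrite kronE [1%:M _ _]mxE eq_sym (negPf ad) mulr0 mul0r.
  by rewrite tvecE kronE [1%:M _ _]mxE eqxx mulr1 mxE bcirctE subKr mulrC.
rewrite mxE !big_bidx; apply: eq_bigr => j _; rewrite (bigD1 b) //=.
rewrite [X in _ + X]big1 ?addr0 => [|c bc]; last first.
  rewrite big1 // => d _.
  by rewrite khatri_raoE blockIE eq_sym (negPf bc) !mul0r.
by apply: eq_bigr => d _; rewrite tvecE khatri_raoE blockIE eqxx mul1r bcircE.
Qed.

Lemma mpinv_unit n (A : 'M[R]_n) : A \in unitmx -> mpinv A = invmx A.
Proof.
move=> uA; apply: xget_unique => [|X [AXA _]].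
  by rewrite /= mulmxV // mulVmx // !mul1mx !trmx1.
by rewrite -[LHS](mulKmx uA) -[A *m X](mulmxK uA) AXA mulmxV // mulmx1.
Qed.

(** A kernel vector is some [tvec T] with [T P + P T = 0], and [sylvester_bound] with right side
    zero gives [T = 0]. Transposing first fits the row-vector criterion [inj_row_free]. *)
Lemma lyapunov_unit p (P : tensor R p p l) : psdmx (bcirc P - 1%:M) ->
  (kron (bcirct P)^T (1%:M : 'M[R]_p) +
     khatri_rao (blockI l p : 'M[R]_(l * p)) (bcirc P)) \in unitmx.
Proof.
move=> P_ge1; rewrite -unitmx_tr -row_free_unit; apply: inj_row_free => v vL.
have [T Tv] := tvec_surj v^T.
apply: trmx_inj; rewrite trmx0 Tv.
suff -> : T = 0.
  by apply/colP => r; rewrite !mxE /tentry; do !case: insub => // ?; rewrite tensor0E.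
have : tvec (tprod T P + tprod P T) = tvec 0.
  rewrite -lyapunov_vec -Tv -[LHS]trmxK trmx_mul trmxK vL trmx0.
  apply/colP => r; have [r' [a ->]] := bidxP r; have [k [b ->]] := bidxP r'.
  by rewrite tvecE tensor0E mxE.
move/tvec_inj/(congr1 (@bcirc R p p l)); rewrite bcirc0 !bcircS.
move=> /(sylvester_bound P_ge1 P_ge1).
rewrite mul0mx mxtrace0 => TT.
apply: bcirc_inj; rewrite bcirc0; apply/matrixP => i j; rewrite [RHS]mxE.
apply/eqP; rewrite -sqrf_eq0 eq_le sqr_ge0 andbT.
exact: le_trans (sqr_entry_le_mxtrace _ i j) TT.
Qed.

End Bcirc.

(** * The vector transport *)

Lemma gram_psdmx (R : realDomainType) m n (A : 'M[R]_(m, n)) : psdmx (A^T *m A).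
Proof.
move=> v.
have := mxtrace_mul_tr_ge0 (v *m A^T).
by rewrite /mxtrace big_ord1 trmx_mul trmxK !mulmxA.
Qed.

(** Since [I + U^T U >= I], [psdmx_sub1_sqrt] passes the lower bound on to the root, which makes it
    invertible. *)
Lemma tsqrt_gramP (R : realType) l n p (U : tensor R n p l.+1) :
  let P := bcirc (tsqrt (tI + tprod (ttr U) U)) in
  [/\ P^T = P, psdmx (P - 1%:M), P \in unitmx
    & P *m P = 1%:M + (bcirc U)^T *m bcirc U].
Proof.
set A := tI + _ => P.
have EA : bcirc A = 1%:M + (bcirc U)^T *m bcirc U by rewrite !bcircS.
have symA : (bcirc A)^T = bcirc A.
  by rewrite EA linearD /= tr_scalar_mx trmx_mul trmxK.
have psdA1 : psdmx (bcirc A - 1%:M).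
  by rewrite EA addrC addKr; apply: gram_psdmx.
have psdA : psdmx (bcirc A).
  move=> v; rewrite -[bcirc A](subrK 1%:M) mulmxDr mulmxDl mxE addr_ge0 //.
  rewrite mulmx1; have := mxtrace_mul_tr_ge0 v; by rewrite /mxtrace big_ord1.
have [symP psdP PP] := tsqrtP symA psdA.
have P_ge1 : psdmx (P - 1%:M) by apply: psdmx_sub1_sqrt => //; rewrite PP.
split=> //; last by rewrite PP.
by rewrite -[P](subrK 1%:M); apply: psdmx_add1_unit.
Qed.

Theorem mainTheorem12 (R : realType) (n p l : nat) (hnp : (p <= n)%N)
  (X U V : tensor R n p l)
  (hX : tStiefel X) (hU : tTangent X U) (hV : tTangent X V)
  (S : tensor R p p l) :
  let P := tsqrt (tI + tprod (ttr U) U) in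
  let Y := tprod (X + U) (tinv P) in
  tvec S = mpinv (kron (bcirct P)^T (1%:M : 'M[R]_p) + khatri_rao ((blockI l p : 'M[R]_(l * p))) (bcirc P))
             *m tvec (tprod (ttr Y) V - tprod (ttr V) Y) ->
  forall (k : 'I_l) (a : 'I_n) (b : 'I_p),
    is_derive (0 : R) (1 : R) (fun t : R => tRetr X (U + t *: V) k a b)
      ((tprod Y S + tprod (tprod (tI - tprod Y (ttr Y)) V) (tinv (tprod (ttr Y) (X + U)))) k a b).
Proof.
move=> P Y ES k a b.
(* With no slices there is no index [k]; otherwise the slice indices form a cyclic group. *)
case: l => [|l] in X U V hX hU hV S P Y ES k *; first by case: k.
set W := tprod Y S + _.
pose Pt t := bcirc (tsqrt (tI + tprod (ttr (U + t *: V)) (U + t *: V))).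
have Pt_spec t := tsqrt_gramP (U + t *: V).
have [symP P_ge1 uP PP] := tsqrt_gramP U.
move: hX hU hV => /(congr1 (@bcirc R p p l.+1)) + /(congr1 (@bcirc R p p l.+1)) +
  /(congr1 (@bcirc R p p l.+1)).
rewrite bcirc0 !bcircS.
have EY : bcirc Y = (bcirc X + bcirc U) *m invmx (bcirc P) by rewrite !bcircS tinvP.
have ESP : bcirc S *m bcirc P + bcirc P *m bcirc S =
    (bcirc Y)^T *m bcirc V - (bcirc V)^T *m bcirc Y.
  rewrite -!bcircS; congr bcirc; apply: tvec_inj; rewrite -lyapunov_vec ES.
  by rewrite mpinv_unit ?lyapunov_unit // mulKVmx // lyapunov_unit.
have EYt t : bcirc (tRetr X (U + t *: V)) *m Pt t =
    bcirc X + bcirc U + t *: bcirc V.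
  have [_ _ uPt _] := Pt_spec t.
  by rewrite bcircM tinvP // mulmxKV // !bcircS addrA.
move: EY; rewrite -!/P in symP P_ge1 uP PP *.
set bX := bcirc X; set bU := bcirc U; set bV := bcirc V; set bP := bcirc P.
set bY := bcirc Y; set bS := bcirc S.
move=> EY XX XU XV; clearbody Y P.
have YP : bY *m bP = bX + bU by rewrite EY mulmxKV.
have YP' : bP *m bY^T = (bX + bU)^T by rewrite -YP trmx_mul symP.
(* The cross terms [X^T U + U^T X] cancel by tangency of [U]. *)
have ZZ : (bX + bU)^T *m (bX + bU) = bP *m bP.
  rewrite PP [(_ + _)^T]linearD /= mulmxDl !mulmxDr XX -addrA; congr (_ + _).
  by rewrite addrA XU add0r.
(* Left multiplication by the invertible [P] reduces this to [ZZ]; the inverse in the conclusion is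
   thus that of [P]. *)
have YZ : bY^T *m (bX + bU) = bP.
  by rewrite -[LHS](mulKmx uP) [bP *m (_ *m _)]mulmxA YP' ZZ mulKmx.
pose A1 := bU^T *m bV + bV^T *m bU.
pose P' := bY^T *m bV - bS *m bP.
pose Y' := bY *m bS + (1%:M - bY *m bY^T) *m bV *m invmx bP.
(* Multiply [ESP] on the right by [P] and use [Y P = X + U] together with its transpose. *)
have EP' : P' *m bP + bP *m P' = A1.
  rewrite /P' mulmxBl mulmxBr !mulmxA YP'.
  have := congr1 (mulmx^~ bP) ESP; rewrite /= mulmxDl mulmxBl.
  rewrite -[_ *m bY *m bP]mulmxA YP.
  move/(canRL (addrK _)) => ESPP; rewrite ESPP.
  (* Tangency of [V] makes the terms in [X] cancel. *)
  have -> : A1 = (bX + bU)^T *m bV + bV^T *m (bX + bU).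
    by rewrite /A1 [(_ + _)^T]linearD /= mulmxDl mulmxDr addrACA XV add0r.
  by apply/matrixP => i j; rewrite !mxE; ring.
have EY' : Y' *m bP + bY *m P' = bV.
  rewrite /Y' /P' mulmxDl mulmxKV // mulmxBl mulmxBr mul1mx !mulmxA.
  by apply/matrixP => i j; rewrite !mxE; ring.
have PtPt t : Pt t *m Pt t = bP *m bP + t *: A1 + t ^+ 2 *: (bV^T *m bV).
  have [_ _ _ ->] := Pt_spec t; rewrite PP !bcircS.
  rewrite [(_ + _)^T]linearD /= [(_ *: _)^T]linearZ /=.
  rewrite mulmxDl !mulmxDr -!scalemxAl -!scalemxAr scalerA -expr2 /A1.
  by rewrite scalerDr -!addrA.
have EY'W : Y' = bcirc W.
  by rewrite !bcircS tinvP !bcircS YZ.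
have [c Hc] : mxO 2 (fun t => bcirc (tRetr X (U + t *: V)) - bY - t *: Y').
  apply: (polar_expansion _ _ P_ge1 PtPt EP' _ _ EY') => t.
  - by have [] := Pt_spec t.
  - by have [] := Pt_spec t.
  - have [_ _ _ ->] := Pt_spec t; rewrite addrC addKr; exact: gram_psdmx.
  - by rewrite YP.
rewrite EY'W in Hc; clearbody W.
apply: (@is_derive_quadratic _ _ (Y k a b) _ c) => t t1.
(* Block column 0 of [bcirc] lists the slices in order, so this entry of the expansion is the tensor
   entry [k a b]. *)
have := Hc t t1 (bidx k a) (bidx ord0 b).
rewrite -bcircZ -!bcircN -!bcircD bcircE !tensorDE !tensorNE tensorZE subr0.
exact.
Qed.
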